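(* Let $d=(d_1,\dots,d_n)$ be a degree sequence (a graphic list), and consider all realizations of $d$ on vertex set $[n]=\{1,\dots,n\}$ in which vertex $\ell$ has degree $d_\ell$ for every $\ell\in[n]$. Let $i,j\in[n]$ with $i<j$. Then $\{i,j\}$ is a forced edge for $d$ if and only if the sequence \[d^+(i,j) = (d_1,\dots,d_{i-1},d_i + 1, d_{i+1}, \dots, d_{j-1}, d_j + 1, d_{j+1},\dots, d_n)\] is not graphic. Moreover, $\{i,j\}$ is a forced non-edge for $d$ if and only if the sequence \[d^-(i,j) = (d_1,\dots,d_{i-1},d_i - 1, d_{i+1}, \dots, d_{j-1}, d_j - 1, d_{j+1},\dots, d_n)\] is not graphic.
   Context: All graphs are finite and simple. A list of integers is graphic if it is the degree sequence of some graph. A realization of $d=(d_1,\dots,d_n)$ is a labeled graph on vertex set $[n]$ in which vertex $\ell$ has degree $d_\ell$; realizations with different edge sets are distinct even if isomorphic. A pair $\{i,j\}$ of distinct vertices is a forced edge for $d$ if $i$ and $j$ are adjacent in every realization of $d$, and a forced non-edge if they are adjacent in no realization of $d$. Throughout, $d_1\ge d_2\ge\dots\ge d_n$. *)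

(* Defs.v *)
From mathcomp Require Import all_boot all_order all_algebra.

Set Implicit Arguments.
Unset Strict Implicit.
Unset Printing Implicit Defensive.

Import Order.TTheory GRing.Theory Num.Theory.
Local Open Scope ring_scope.

Record sgraph (T : finType) := SGraph {
  adj :> rel T;
  adj_sym : symmetric adj;
  adj_irrefl : irreflexive adj
}.

Definition degree (T : finType) (G : sgraph T) (v : T) : nat :=
  #|[set w | G v w]|.

(* A degree sequence is only determined up to the order in which the vertices
   are listed, hence [perm_eq]. Lists have integer entries, because decreasing
   a degree may produce the (non-graphic) entry -1. *)
Definition graphic (s : seq int) : Prop :=
  exists (T : finType) (G : sgraph T),
    perm_eq s [seq (degree G v)%:Z | v <- enum T].

(* The vertex set [n] = {1, ..., n} is represented by 'I_n = {0, ..., n-1}. *)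
Definition realization (n : nat) (d : n.-tuple int) (G : sgraph 'I_n) : Prop :=
  forall l : 'I_n, (degree G l)%:Z = tnth d l.

Definition forced_edge (n : nat) (d : n.-tuple int) (i j : 'I_n) : Prop :=
  i != j /\ forall G : sgraph 'I_n, realization d G -> G i j.

Definition forced_nonedge (n : nat) (d : n.-tuple int) (i j : 'I_n) : Prop :=
  i != j /\ forall G : sgraph 'I_n, realization d G -> ~~ G i j.

Definition dplus (n : nat) (d : n.-tuple int) (i j : 'I_n) : n.-tuple int :=
  [tuple if (l == i) || (l == j) then tnth d l + 1 else tnth d l | l < n].

Definition dminus (n : nat) (d : n.-tuple int) (i j : 'I_n) : n.-tuple int :=
  [tuple if (l == i) || (l == j) then tnth d l - 1 else tnth d l | l < n].

(* Main.v *)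
Require Import Defs.
From mathcomp Require Import all_boot all_order all_algebra.
From mathcomp Require Import perm zify.

Set Implicit Arguments.
Unset Strict Implicit.
Unset Printing Implicit Defensive.

Import Order.TTheory GRing.Theory Num.Theory.
Local Open Scope ring_scope.

(** Adding (deleting) the edge ij turns a realization of d in which i and j are
    not adjacent (are adjacent) into one of d^+ (d^-), which gives one direction
    of each equivalence.  Conversely, let G realize d and H realize d^+, with ij
    an edge of G only.  Starting from G - ij, follow a walk from i alternately
    adding edges of H and deleting edges outside H: the current graph approaches
    H, so the walk ends, and it can only end at j, giving a realization of d
    avoiding ij, or at i, giving degrees d + e_i - e_j.  In the latter case, if
    d_i >= d_j, some neighbour w of i is not a neighbour of j, and replacing iw
    by jw repairs the degrees.  The second equivalence follows by taking
    complements. *)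

(** * Toggling an edge and its effect on degrees *)

Section SimpleGraphs.
Variable T : finType.
Implicit Types (G H K : sgraph T) (x y z : T) (d : T -> int).

Lemma degree_sum G x : (degree G x)%:Z = \sum_y (G x y)%:Z.
Proof.
rewrite /degree -sum1dep_card big_mkcond /= -natz natr_sum.
by apply: eq_bigr => y _; case: (G x y).
Qed.

(** The conjunct [u != v] keeps the relation irreflexive even when [x = y], so toggling is total. *)
Definition flip_rel G x y : rel T :=
  fun u v => G u v (+) [&& u != v & (u == x) && (v == y) || (u == y) && (v == x)].

Lemma flip_sym G x y : symmetric (flip_rel G x y).
Proof.
move=> u v; rewrite /flip_rel adj_sym eq_sym; congr (_ (+) (_ && _)).
by rewrite orbC andbC [X in _ || X]andbC.
Qed.

Lemma flip_irrefl G x y : irreflexive (flip_rel G x y).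
Proof. by move=> u; rewrite /flip_rel adj_irrefl eqxx. Qed.

Definition flip G x y : sgraph T := SGraph (flip_sym G x y) (flip_irrefl G x y).

Lemma complement_sym G : symmetric (fun x y => (x != y) && ~~ G x y).
Proof. by move=> x y; rewrite eq_sym adj_sym. Qed.

Lemma complement_irrefl G : irreflexive (fun x y => (x != y) && ~~ G x y).
Proof. by move=> x; rewrite eqxx. Qed.

Definition complement G : sgraph T :=
  SGraph (complement_sym G) (complement_irrefl G).

Lemma degree_flip G x y z : x != y ->
  (degree (flip G x y) z)%:Z =
  (degree G z)%:Z + (-1) ^+ G x y * ((z == x)%:Z + (z == y)%:Z).
Proof.
move=> neq_xy.
(* Each indicator becomes a sum over the possible other endpoint, so the formula can be checked one
   adjacency at a time. *)
have sum_eq (c : int) (u : T) : c = \sum_v c * (v == u)%:Z.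
  rewrite (bigD1 u) //= eqxx mulr1 big1 ?addr0 // => v /negbTE->.
  exact: mulr0.
rewrite !degree_sum [(z == x)%:Z](sum_eq _ y) [(z == y)%:Z](sum_eq _ x).
rewrite -big_split /= mulr_sumr -big_split /=.
apply: eq_bigr => u _; rewrite /flip_rel.
have [->|neq_zx] := eqVneq z x.
  rewrite (negbTE neq_xy) orbF mul1r mul0r addr0.
  have [->|] := eqVneq u y; first by rewrite neq_xy; case: (G x y).
  by rewrite /= ?andbF addbF mulr0 addr0.
rewrite mul0r add0r; have [->|neq_zy] := eqVneq z y.
  rewrite mul1r; have [->|] := eqVneq u x.
    by rewrite eq_sym neq_xy adj_sym; case: (G x y).
  by rewrite /= ?andbF addbF mulr0 addr0.
by rewrite /= ?andbF addbF mul0r mulr0 addr0.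
Qed.

Lemma degree_add_edge G x y z : x != y -> ~~ G x y ->
  (degree (flip G x y) z)%:Z = (degree G z)%:Z + (z == x)%:Z + (z == y)%:Z.
Proof.
by move=> neq_xy /negbTE nGxy; rewrite degree_flip // nGxy mul1r addrA.
Qed.

Lemma degree_del_edge G x y z : G x y ->
  (degree (flip G x y) z)%:Z = (degree G z)%:Z - (z == x)%:Z - (z == y)%:Z.
Proof.
move=> Gxy; have neq_xy : x != y.
  by apply: contraTneq Gxy => ->; rewrite adj_irrefl.
by rewrite degree_flip // Gxy mulN1r opprD addrA.
Qed.

Lemma flip_adj G x y : x != y -> flip G x y x y = ~~ G x y.
Proof. by move=> neq_xy; rewrite /= /flip_rel neq_xy !eqxx addbT. Qed.

Lemma flip_sub G H x y u v :
  H x y -> flip G x y u v -> G u v || H u v.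
Proof.
move=> Hxy /=; rewrite /flip_rel; case: (G u v) => //= /andP[_].
by case/orP=> /andP[/eqP-> /eqP->] //; rewrite adj_sym.
Qed.

Lemma flip_sub_del G x y u v : G x y -> flip G x y u v -> G u v.
Proof. by move=> Gxy /(flip_sub Gxy); rewrite orbb. Qed.

(** Otherwise the neighbourhood of [y] in [H] would lie inside that of [x] in [G]. The walk compares
    two graphs at one vertex; the final repair compares two vertices of one graph. *)
Lemma degree_lt_neighbor G H x y :
  (degree G x < degree H y)%N -> exists2 z, H y z & ~~ G x z.
Proof.
rewrite ltnNge => /negP nle.
case: (pickP [pred z | H y z && ~~ G x z]) => [z /andP[]|no]; first by exists z.
case: nle; apply/subset_leq_card/subsetP => z; rewrite !inE => Hyz.
by have /= := no z; rewrite Hyz => /negbFE.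
Qed.

(** * Alternating walks towards a target graph *)

Definition disagreements G H := #|[set p | G p.1 p.2 != H p.1 p.2]|.

(** Toggling a pair on which the graphs differ repairs both of its orderings and touches nothing
    else; this makes the walk terminate. *)
Lemma disagreements_flip G H x y :
  G x y != H x y -> (disagreements (flip G x y) H < disagreements G H)%N.
Proof.
move=> neq; have neq_xy : x != y.
  by apply: contraNneq neq => ->; rewrite !adj_irrefl.
apply/proper_card/properP; split; last first.
  exists (x, y); rewrite inE //= /flip_rel neq_xy !eqxx addbT negbK.
  by case: (G x y) (H x y) neq => -[].
apply/subsetP => -[u v]; rewrite !inE /= /flip_rel.
case: andP => [[_ /orP uvE]|_]; last by rewrite addbF.
by case: uvE => /andP[/eqP-> /eqP->] // _; rewrite adj_sym [H _ _]adj_sym.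
Qed.

(* The jump system property of degree sequences; K is the current graph of an
   alternating walk which started at i and has now arrived at v. *)
Lemma alternating_walk (a : T -> int) (i v : T) (K H : sgraph T) :
  (forall x, (degree K x)%:Z = a x + (x == i)%:Z - (x == v)%:Z) ->
  (forall x, a x <= (degree H x)%:Z) -> a i < (degree H i)%:Z ->
  exists w (K' : sgraph T),
    [/\ a w + (w == i)%:Z < (degree H w)%:Z,
        forall x, (degree K' x)%:Z = a x + (x == i)%:Z + (x == w)%:Z
      & forall x y, K' x y -> K x y || H x y].
Proof.
move=> degK le_aH lt_aH; have [m] := ubnP (disagreements K H).
elim: m => // m IHm in K v degK *; rewrite ltnS => le_m.
(* If [v = i] the corrections in [degK] cancel and [lt_aH] gives the gap; otherwise the -1 at [v]
   does. *)
have /degree_lt_neighbor[w Hvw nKvw] : (degree K v < degree H v)%N.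
  rewrite -ltz_nat degK eqxx; have := le_aH v.
  by case: eqVneq => [->|_] /=; lia.
have neq_vw : v != w by apply: contraTneq Hvw => ->; rewrite adj_irrefl.
have degK1 x : (degree (flip K v w) x)%:Z = a x + (x == i)%:Z + (x == w)%:Z.
  by rewrite degree_add_edge // degK; lia.
(* The walk stops at [w] if [H] has room there. If not, adding [vw] has overfilled [w], so some edge
   [wu] outside [H] can be deleted, and the walk goes on from [u]. *)
have [lt_w|le_w] := ltP (a w + (w == i)%:Z) (degree H w)%:Z.
  by exists w, (flip K v w); split=> // x y; apply: flip_sub.
have /degree_lt_neighbor[u K1wu nHwu] : (degree H w < degree (flip K v w) w)%N.
  by rewrite -ltz_nat degK1 eqxx /=; lia.
have lt1 : (disagreements (flip K v w) H < disagreements K H)%N.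
  by apply: disagreements_flip; rewrite Hvw (negbTE nKvw).
have lt2 : (disagreements (flip (flip K v w) w u) H <
            disagreements (flip K v w) H)%N.
  by apply: disagreements_flip; rewrite K1wu (negbTE nHwu).
have [||z [K' [lt_z degK' subK']]] := IHm (flip (flip K v w) w u) u.
- by move=> x; rewrite degree_del_edge // degK1; lia.
- by lia.
exists z, K'; split=> // x y /subK' /orP[|->]; last by rewrite orbT.
by move/(flip_sub_del K1wu); apply: flip_sub.
Qed.

(** * Realizations avoiding or containing a given edge *)

Definition realizes G d := forall x, (degree G x)%:Z = d x.

Lemma realization_avoiding_edge d (i j : T) (G H : sgraph T) :
  i != j -> realizes G d ->
  realizes H (fun x => d x + (x == i)%:Z + (x == j)%:Z) ->
  exists2 K : sgraph T, realizes K d & ~~ K i j.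
Proof.
(* The order matters only for the final repair, when the walk from [i] ends back at [i]. *)
wlog le_ji : i j / d j <= d i => [hwlog neq_ij rG rH|neq_ij rG rH].
  have [le_ji|/ltW le_ij] := leP (d j) (d i); first exact: hwlog.
  have [|||K rK nK] := hwlog _ _ le_ij; rewrite // 1?eq_sym //.
    by move=> x; rewrite rH addrAC.
  by exists K; rewrite // adj_sym.
have [Gij|nGij] := boolP (G i j); last by exists G.
have [Hij|nHij] := boolP (H i j).
  exists (flip H i j); last by rewrite flip_adj ?Hij.
  by move=> x; rewrite degree_del_edge // rH; lia.
(* These are the degrees of [G] minus the edge [ij]. *)
pose a x := d x - (x == i)%:Z - (x == j)%:Z.
have [|||w [K [lt_w degK subK]]] := @alternating_walk a i i (flip G i j) H.
- by move=> x; rewrite degree_del_edge // rG /a; lia.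
- by move=> x; rewrite rH /a; lia.
- by rewrite rH /a eqxx; lia.
have nKij : ~~ K i j.
  by apply/negP => /subK; rewrite flip_adj // Gij (negbTE nHij).
have [wj|neq_wj] := eqVneq w j.
  by exists K => // x; rewrite degK /a wj; lia.
(* Away from [i] and [j], [a] already equals the degree in [H], so the walk cannot stop there. *)
have wi : w = i.
  by apply: contraTeq lt_w; rewrite rH /a (negbTE neq_wj) => /negbTE->; lia.
have degK' x : (degree K x)%:Z = d x + (x == i)%:Z - (x == j)%:Z.
  by rewrite degK /a wi; lia.
(* By [le_ji], d_j - 1 < d_i + 1. The edge [iu] will be replaced by [ju]. *)
have /degree_lt_neighbor[u Kiu nKju] : (degree K j < degree K i)%N.
  by rewrite -ltz_nat !degK' !eqxx (negbTE neq_ij) eq_sym (negbTE neq_ij); lia.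
have neq_ju : j != u by apply: contraTneq Kiu => <-.
pose K1 := flip K i u.
have nK1ju : ~~ K1 j u by apply: contra nKju; apply: flip_sub_del.
exists (flip K1 j u) => [x|].
  by rewrite degree_add_edge // degree_del_edge // degK'; lia.
have neq_iu : i != u by apply: contraTneq Kiu => <-; rewrite adj_irrefl.
rewrite /= /flip_rel /K1 /= /flip_rel (negbTE nKij) (negbTE neq_ij).
by rewrite (negbTE neq_iu) (negbTE neq_ju) !andbF.
Qed.

Lemma degree_complement G x :
  (degree (complement G) x)%:Z = #|T|%:Z - 1 - (degree G x)%:Z.
Proof.
have -> : #|T|%:Z = 1 + \sum_(y | y != x) 1.
  by rewrite -sum1_card -natz natr_sum (bigD1 x).
rewrite [1 + _]addrC addrK !degree_sum (bigD1 x) //= eqxx add0r.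
rewrite [\sum_y (G x y)%:Z](bigD1 x) //= adj_irrefl add0r -sumrB.
by apply: eq_bigr => y; rewrite eq_sym => ->; case: (G x y).
Qed.

(** Complementation sends degrees d to |T| - 1 - d, which turns lowering at [i] and [j] into raising
    and edges into non-edges. *)
Lemma realization_containing_edge d (i j : T) (G H : sgraph T) :
  i != j -> realizes G d ->
  realizes H (fun x => d x - (x == i)%:Z - (x == j)%:Z) ->
  exists2 K : sgraph T, realizes K d & K i j.
Proof.
move=> neq_ij rG rH.
have [|||K rK nKij] := @realization_avoiding_edge
    (fun x => #|T|%:Z - 1 - d x) i j (complement G) (complement H) => //.
- by move=> x; rewrite degree_complement rG.
- by move=> x; rewrite degree_complement rH; lia.
exists (complement K); last by rewrite /= neq_ij.
by move=> x; rewrite degree_complement rK; lia.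
Qed.

End SimpleGraphs.

(** * From unordered degree lists to labelled realizations *)

Lemma graphicP n (d : n.-tuple int) :
  graphic d <-> exists G : sgraph 'I_n, realization d G.
Proof.
split=> [[T [G d_perm]]|[G rG]]; last first.
  exists 'I_n, G; rewrite (eq_map rG) map_tnth_enum; exact: perm_refl.
have cardT : #|T| = n.
  rewrite cardE -(size_map (fun v => (degree G v)%:Z)) -(perm_size d_perm).
  exact: size_tuple.
case: n / cardT d d_perm => d d_perm.
have enumT : perm_eq (enum T) [seq enum_val k | k <- enum 'I_#|T|].
  apply: uniq_perm; rewrite ?(map_inj_uniq enum_val_inj) ?enum_uniq // => v.
  by rewrite mem_enum -[v]enum_rankK map_f ?mem_enum.
have := perm_trans d_perm (perm_map (fun v => (degree G v)%:Z) enumT).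
rewrite -map_comp => {}d_perm.
have {d_perm} : perm_eq d [tuple (degree G (enum_val k))%:Z | k < #|T|] by [].
case/tuple_permP => p dE.
(* Entry [k] of [d] is the degree of [f k], so pulling [G] back along [f] puts every degree at its
   index. *)
pose f k := enum_val (p k).
have f_bij : bijective f by apply: bij_comp (enum_val_bij T) (injF_bij perm_inj).
pose r : rel 'I_#|T| := fun k l => G (f k) (f l).
have r_sym : symmetric r by move=> k l; apply: adj_sym.
have r_irr : irreflexive r by move=> k; apply: adj_irrefl.
exists (SGraph r_sym r_irr) => k.
have -> : d = [tuple (degree G (enum_val (p k)))%:Z | k < #|T|].
  by apply: val_inj; rewrite /= dE; apply: eq_map => l; rewrite tnth_mktuple.
rewrite tnth_mktuple; congr Posz; rewrite /degree.
rewrite -(on_card_preimset (onW_bij _ f_bij)); apply: eq_card => l.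
by rewrite !inE.
Qed.

Lemma tnth_dplus n (d : n.-tuple int) (i j l : 'I_n) : i != j ->
  tnth (dplus d i j) l = tnth d l + (l == i)%:Z + (l == j)%:Z.
Proof.
move=> neq_ij; rewrite tnth_mktuple; have [->|_] := eqVneq l i.
  by rewrite (negbTE neq_ij) addr0.
by rewrite addr0; case: (l == j); rewrite /= ?addr0.
Qed.

Lemma tnth_dminus n (d : n.-tuple int) (i j l : 'I_n) : i != j ->
  tnth (dminus d i j) l = tnth d l - (l == i)%:Z - (l == j)%:Z.
Proof.
move=> neq_ij; rewrite tnth_mktuple; have [->|_] := eqVneq l i.
  by rewrite (negbTE neq_ij) subr0.
by rewrite subr0; case: (l == j); rewrite /= ?subr0.
Qed.

Theorem theorem2p1 (n : nat) (d : n.-tuple int)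
    (d_sorted : sorted (fun x y : int => y <= x) d)
    (d_graphic : graphic d)
    (i j : 'I_n) (lt_ij : (i < j)%N) :
  (forced_edge d i j <-> ~ graphic (dplus d i j)) /\
  (forced_nonedge d i j <-> ~ graphic (dminus d i j)).
Proof.
have neq_ij : i != j by rewrite neq_ltn lt_ij.
have [G rG] := (graphicP d).1 d_graphic.
split; split.
- case=> _ forced /graphicP[H rH].
  have [||K rK] := @realization_avoiding_edge _ (tnth d) i j G H neq_ij => //.
    by move=> x; rewrite rH tnth_dplus.
  by rewrite forced.
- move=> not_graphic; split=> // K rK; apply: contra_notT not_graphic => nKij.
  apply/graphicP; exists (flip K i j) => x.
  by rewrite degree_add_edge // rK tnth_dplus.
- case=> _ forced /graphicP[H rH].
  have [||K rK] := @realization_containing_edge _ (tnth d) i j G H neq_ij => //.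
    by move=> x; rewrite rH tnth_dminus.
  by apply/negP/forced.
- move=> not_graphic; split=> // K rK; apply: contra_notN not_graphic => Kij.
  apply/graphicP; exists (flip K i j) => x.
  by rewrite degree_del_edge // rK tnth_dminus.
Qed.
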